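(* Let $X$ be a nonempty set. For every integer $n\ge 2$, we have $\mathcal{F}^n_n\setminus\mathcal{F}^n_{n-1}\neq\varnothing$ if and only if $|X|\ge 3$.
   Context: An operation $F\colon X^n\to X$ is associative if $F(x_1,\ldots,x_{i-1},F(x_i,\ldots,x_{i+n-1}),x_{i+n},\ldots,x_{2n-1})=F(x_1,\ldots,x_i,F(x_{i+1},\ldots,x_{i+n}),x_{i+n+1},\ldots,x_{2n-1})$ for all $x_1,\ldots,x_{2n-1}\in X$ and $1\le i\le n-1$. For $k\in\{1,\ldots,n\}$, $\mathcal{F}^n_k$ is the class of associative operations $F\colon X^n\to X$ such that $F(x_1,\ldots,x_n)\in\{x_1,\ldots,x_n\}$ whenever at least $k$ of the components $x_1,\ldots,x_n$ are equal to each other. *)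

(* Defs.v *)
From mathcomp Require Import all_boot zify.
From mathcomp Require Import boolp classical_sets functions cardinality.

Set Implicit Arguments.
Unset Strict Implicit.
Unset Printing Implicit Defensive.

Local Open Scope classical_set_scope.

(* An n-ary operation on X is a function n.-tuple X -> X.  Components are
   numbered from 0, so the i-th block of n consecutive components of a word of
   length 2n-1 starts at i : 'I_n. *)

Lemma window_subproof (X : Type) (n : nat) (x : (2 * n).-1.-tuple X)
  (i : 'I_n) : size (take n (drop i x)) == n.
Proof.
apply/eqP; rewrite size_takel // size_drop size_tuple.
by have := ltn_ord i; lia.
Qed.

(* (x_i, ..., x_{i+n-1}) *)
Definition window (X : Type) (n : nat) (x : (2 * n).-1.-tuple X) (i : 'I_n) :
  n.-tuple X := Tuple (window_subproof x i).

Lemma nest_subproof (X : Type) (n : nat) (F : n.-tuple X -> X)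
  (x : (2 * n).-1.-tuple X) (i : 'I_n) :
  size (take i x ++ F (window x i) :: drop (i + n) x) == n.
Proof.
apply/eqP; rewrite size_cat /= size_drop size_takel size_tuple;
  by have := ltn_ord i; lia.
Qed.

(* (x_0, ..., x_{i-1}, F(x_i, ..., x_{i+n-1}), x_{i+n}, ..., x_{2n-2}) *)
Definition nest (X : Type) (n : nat) (F : n.-tuple X -> X)
  (x : (2 * n).-1.-tuple X) (i : 'I_n) : n.-tuple X :=
  Tuple (nest_subproof F x i).

Definition nary_associative (X : Type) (n : nat) (F : n.-tuple X -> X) : Prop :=
  forall (x : (2 * n).-1.-tuple X) (i j : 'I_n),
    j = i.+1 :> nat -> F (nest F x i) = F (nest F x j).

(* at least k of the components of x are equal to each other *)
Definition at_least_equal (X : Type) (n k : nat) (x : n.-tuple X) : Prop :=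
  exists A : {set 'I_n}, k <= #|A| /\
    forall i j : 'I_n, i \in A -> j \in A -> tnth x i = tnth x j.

Definition Fclass (X : Type) (n k : nat) : set (n.-tuple X -> X) :=
  [set F | nary_associative F /\
    forall x : n.-tuple X, at_least_equal k x -> exists i, F x = tnth x i].

Arguments Fclass X n k : clear implicits.

(* Main.v *)
(* If |X| <= 2, a word with two distinct components exhausts X, so the value of
   an operation preserving constant words is always one of its arguments.
   Conversely, fix c in X: the n-ary meet of the flat semilattice with bottom c
   (constant words x...x go to x, all others to c) is associative and
   idempotent, yet sends (a, b, ..., b) to c when a, b, c are distinct. *)
Require Import Defs.
From mathcomp Require Import all_boot.
From mathcomp Require Import boolp classical_sets functions cardinality.

Local Open Scope classical_set_scope.
Local Open Scope card_scope.

Lemma three_card_leP (X : Type) :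
  `I_3 #<= [set: X] <-> exists a b c : X, [/\ a <> b, a <> c & b <> c].
Proof.
split=> [/card_leP[f]|[a [b [c [ab ac bc]]]]].
  pose g i (hi : `I_3 i) := \val (f (SigSub (mem_set hi))).
  have g_inj i j (hi : `I_3 i) (hj : `I_3 j) : i <> j -> g i hi <> g j hj.
    move=> ij /val_inj eq_f; apply: ij.
    suff : SigSub (mem_set hi) = SigSub (mem_set hj) by case.
    by apply: (inj _ _ eq_f); apply/mem_set.
  by exists (g 0 erefl), (g 1 erefl), (g 2 erefl); split; apply: g_inj.
suff /injfunPex[f] : exists2 f : nat -> X, set_fun `I_3 setT f & set_inj `I_3 f.
  exact: inj_card_le f.
(* Indices 0, 1, 2 go to [a], [b], [c], the last one through the default value of [nth]. *)
exists (nth c [:: a; b]) => //.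
by move=> [|[|[|i]]] [|[|[|j]]] /set_mem // ? /set_mem // ? /=; congruence.
Qed.

(** A value outside the word, together with two distinct components, would give three distinct
    elements; so the word is constant, where [F] returns a component. *)
Lemma value_is_argument (X : Type) (n : nat) (F : n.-tuple X -> X)
    (x : n.-tuple X) :
  ~ (`I_3 #<= [set: X]) -> Fclass X n n F -> exists i, F x = tnth x i.
Proof.
move=> X_small [_ F_idem]; apply: contrapT => Fx.
have Fx_neq i : F x <> tnth x i by move=> ?; apply: Fx; exists i.
apply: Fx; apply: F_idem; exists [set: 'I_n]%SET.
rewrite cardsT card_ord leqnn; split=> // i j _ _.
apply: contrapT => xij; apply: X_small; apply/three_card_leP.
by exists (F x), (tnth x i), (tnth x j).
Qed.

Definition flat_meet {X : eqType} (c : X) (s : seq X) : X :=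
  if constant s then head c s else c.

Lemma flat_meet_eq (X : eqType) (c d : X) (s : seq X) :
  d != c -> 0 < size s -> (flat_meet c s == d) = all (pred1 d) s.
Proof.
rewrite /flat_meet; case: s => //= a s dc _.
have [-> | ad] /= := eqVneq a d.
  by case: ifP; rewrite ?eqxx // [c == d]eq_sym (negPf dc).
by case: ifP => _; rewrite ?(negPf ad) // [c == d]eq_sym (negPf dc).
Qed.

(** For [d != c], the nested value is [d] exactly when every letter of [x] is [d], a condition that
    ignores where the inner bracket stands. *)
Lemma flat_meet_assoc (X : eqType) (c : X) (n : nat) :
  0 < n -> nary_associative (fun x : n.-tuple X => flat_meet c x).
Proof.
move=> n_gt0 x i j _.
have nestE d k : d != c ->
    (flat_meet c (nest (fun y : n.-tuple X => flat_meet c y) x k) == d)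
      = all (pred1 d) x.
  move=> dc; rewrite flat_meet_eq ?size_tuple // /nest /= all_cat /=.
  rewrite flat_meet_eq ?(eqP (window_subproof _ _)) //.
  (* The pieces before, inside and after the window concatenate to [x]. *)
  by rewrite addnC -drop_drop -!all_cat !cat_take_drop.
set u := flat_meet _ _; set v := flat_meet _ _.
(* If either value differs from [c], [nestE] transfers it to the other; otherwise both are [c]. *)
have [uc | uc] := eqVneq u c; last first.
  by apply/esym/eqP; rewrite nestE // -(nestE _ i uc).
have [-> // | vc] := eqVneq v c.
by apply/eqP; rewrite nestE // -(nestE _ j vc).
Qed.

Lemma flat_meet_in_Fclass (X : eqType) (c : X) (n : nat) :
  0 < n -> Fclass X n n (fun x => flat_meet c x).
Proof.
move=> n_gt0; split; first exact: flat_meet_assoc.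
move=> x [A [A_card xA]]; exists (Ordinal n_gt0).
have A_full : A = [set: 'I_n]%SET.
  by apply/eqP; rewrite eqEcard finset.subsetT cardsT card_ord.
set d := tnth x _.
have x_const : all (pred1 d) x.
  by apply/all_tnthP => i /=; apply/eqP; apply: xA; rewrite A_full inE.
have x_size : 0 < size x by rewrite size_tuple.
(* For [d = c], [flat_meet_eq] does not apply, but the head and the default are then both [c]. *)
have [dc | dc] := eqVneq d c; last by apply/eqP; rewrite flat_meet_eq.
rewrite /flat_meet; case: ifP => // _.
by rewrite /d (tnth_nth c) nth0.
Qed.

Lemma flat_meet_notin_Fclass (X : eqType) (a b c : X) (n : nat) :
    a != b -> a != c -> b != c -> 1 < n ->
  ~ Fclass X n n.-1 (fun x => flat_meet c x).
Proof.
case: n => [|[|n]] // ab ac bc _ [_ /(_ [tuple of a :: nseq n.+1 b])] [].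
  (* The arity is now [n.+2]; the [n.+1] positions after the first all carry [b]. *)
  exists [set~ ord0]%SET; split; first by rewrite cardsC1 card_ord.
  have tnth_b i : i \in [set~ ord0]%SET -> tnth [tuple of a :: nseq n.+1 b] i = b.
    rewrite !inE; case: (unliftP ord0 i) => [j -> _|-> /eqP //].
    by rewrite tnthS (tnth_nth b) nth_nseq if_same.
  by move=> i j /tnth_b-> /tnth_b->.
move=> i; rewrite /flat_meet /= [b == a]eq_sym (negPf ab) /= => c_in.
have := mem_tnth i [tuple of a :: nseq n.+1 b].
by rewrite -c_in inE mem_nseq ![c == _]eq_sym (negPf ac) (negPf bc).
Qed.

Theorem proposition1p12 (X : Type) (hX : inhabited X) (n : nat) (hn : 2 <= n) :
  Fclass X n n `\` Fclass X n n.-1 !=set0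
  <-> `I_3 #<= [set: X].
Proof.
split=> [[F [F_n F_n1]]|/three_card_leP[a [b [c [ab ac bc]]]]].
  apply: contrapT => X_small; apply: F_n1; split=> [|x _]; first by case: F_n.
  exact: value_is_argument.
(* [{classic X}] equips [X] with the decidable equality that [flat_meet] tests. *)
exists (fun x => @flat_meet {classic X} c x); split.
  exact: (@flat_meet_in_Fclass {classic X}) (ltnW hn).
by apply: (@flat_meet_notin_Fclass {classic X} a b) => //; apply/eqP.
Qed.
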